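(* Let $M$ be a finite commutative monoid with zero $z$ and group of units $G$ such that the ideal $M\setminus G$ of nonunits is principal and generated by a nilpotent element $t$. Let $k\geq0$ be largest with $t^k\neq z$, and let $G_i$ be the stabilizer of $t^i$ in $G$ for $0\leq i\leq k$. For $\chi\in\widehat G$, let $i_\chi$ be the largest index $i$ (with $0\le i\le k$) such that $G_i\subseteq\ker\chi$. Then the ideals of $M$ are the $Mt^i$ with $0\leq i\leq k+1$, which form a chain, and $$\widetilde\theta_M=\pm\prod_{\chi\in\widehat G}\left(\prod_{0\leq i\leq i_\chi}\frac1{|G_i|}\right)\left(\sum_{g\in G}\overline{\chi(g)}\,x_{gt^{i_\chi}}\right)^{i_\chi+1}.$$
   Context: $\widehat G$ is the group of characters $\chi\colon G\to\mathbb C^\times$ of the finite abelian group $G$. Ideals are nonempty subsets $J\subseteq M$ with $MJ\subseteq J$. Nilpotent means some power equals $z$. The contracted semigroup determinant $\widetilde\theta_M\in\mathbb C[x_m\mid m\in M\setminus\{z\}]$ is the determinant of the $(M\setminus\{z\})\times(M\setminus\{z\})$ matrix with $(s,u)$-entry $x_{su}$ if $su\neq z$ and $0$ otherwise. The symbol $\pm$ means equality up to a sign. *)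

(* Defs.v *)
From HB Require Import structures.
From mathcomp Require Import all_boot.

Set Implicit Arguments.
Unset Strict Implicit.
Unset Printing Implicit Defensive.

HB.mixin Record Monoid_isCommutative M of Monoid M := {
  mulmC : commutative (@mul M)
}.

#[short(type="finComMonoidType")]
HB.structure Definition FinComMonoid :=
  {M of Monoid_isCommutative M & Monoid M & Finite M}.

Bind Scope group_scope with FinComMonoid.sort.

(* fingroup must be loaded only now: Hierarchy Builder rejects the structure   *)
(* above once FinStarMonoid, which also joins Monoid and Finite, is known.     *)
From mathcomp Require Import all_order all_algebra all_fingroup.
From mathcomp Require Import cyclic reals complex mpoly.

Import GRing.Theory Num.Theory.
Local Open Scope ring_scope.

Section Monoids.
Variable M : finComMonoidType.
Implicit Types (m x z t : M) (J : {set M}).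

Definition is_zero z := forall m, (z * m = z)%g /\ (m * z = z)%g.

Definition nilpotent_elt z t := exists n, (t ^+ n)%g = z.

Definition is_ideal J :=
  J != set0 /\ forall m x, x \in J -> (m * x)%g \in J.

Definition principal_ideal x : {set M} := [set (m * x)%g | m : M].

Definition invertible m := [exists n : M, (m * n == 1)%g && (n * m == 1)%g].

Definition nonunits : {set M} := [set m | ~~ invertible m].

End Monoids.

Section UnitGroup.
Variable M : finComMonoidType.

Record munit := MUnit { munit_val : M; _ : invertible munit_val }.

HB.instance Definition _ := [isSub for munit_val].
HB.instance Definition _ := [Finite of munit by <:].

Implicit Types u v : munit.

Fact munit1_subproof : invertible (1%g : M).
Proof. by apply/existsP; exists 1%g; rewrite mulg1 eqxx. Qed.

Fact munitM_subproof u v : invertible (munit_val u * munit_val v)%g.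
Proof.
case: u v => [u ui] [v vi] /=.
have /existsP[u' /andP[/eqP uK /eqP u'K]] := ui.
have /existsP[v' /andP[/eqP vK /eqP v'K]] := vi.
apply/existsP; exists (v' * u')%g; apply/andP; split; apply/eqP.
  by rewrite mulgA -(mulgA u) vK mulg1.
by rewrite mulgA -(mulgA v') u'K mulg1.
Qed.

Definition munit_inv_val u : M :=
  odflt 1%g [pick n : M | (munit_val u * n == 1)%g && (n * munit_val u == 1)%g].

Fact munit_inv_valP u :
  (munit_val u * munit_inv_val u = 1)%g /\ (munit_inv_val u * munit_val u = 1)%g.
Proof.
rewrite /munit_inv_val; case: pickP => [n /andP[/eqP ? /eqP ?] //|no].
by case: u no => u /= /existsP[n Pn] /(_ n); rewrite Pn.
Qed.

Fact munitV_subproof u : invertible (munit_inv_val u).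
Proof.
by have [uK Ku] := munit_inv_valP u; apply/existsP; exists (munit_val u); rewrite uK Ku eqxx.
Qed.

Definition munit_one := MUnit munit1_subproof.
Definition munit_mul u v := MUnit (munitM_subproof u v).
Definition munit_inv u := MUnit (munitV_subproof u).

Fact munit_mulA : associative munit_mul.
Proof. by move=> u v w; apply: val_inj; apply: mulgA. Qed.
Fact munit_mul1 : left_id munit_one munit_mul.
Proof. by move=> u; apply: val_inj; apply: mul1g. Qed.
Fact munit_mulr1 : right_id munit_one munit_mul.
Proof. by move=> u; apply: val_inj; apply: mulg1. Qed.
Fact munit_mulV : left_inverse munit_one munit_inv munit_mul.
Proof. by move=> u; apply: val_inj; case: (munit_inv_valP u). Qed.
Fact munit_mulrV : right_inverse munit_one munit_inv munit_mul.
Proof. by move=> u; apply: val_inj; case: (munit_inv_valP u). Qed.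

HB.instance Definition _ :=
  isGroup.Build munit
    munit_mulA munit_mul1 munit_mulr1 munit_mulV munit_mulrV.

Definition unit_stab (x : M) : {set munit} := [set g | (munit_val g * x)%g == x].

End UnitGroup.

Section Characters.
Variables (gT : finGroupType) (C : numClosedFieldType).

(* A homomorphism from gT to the multiplicative group of nonzero elements of C *)
Definition is_group_char (f : {ffun gT -> C}) :=
  [forall x : gT, f x != 0] && [forall x : gT, forall y : gT, f (x * y)%g == f x * f y].

Record group_char :=
  GroupChar { group_char_fun :> {ffun gT -> C};
              _ : is_group_char group_char_fun }.

HB.instance Definition _ := [isSub for group_char_fun].
HB.instance Definition _ := [Choice of group_char by <:].

(* Finiteness: the values of a character are #|gT|-th roots of unity, hence    *)
(* characters embed into the functions from gT to the finite set of the roots. *)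
Definition char_roots : seq C :=
  sval (closed_field_poly_normal ('X^#|gT| - 1 : {poly C})).

Fact group_char_rootsP (chi : group_char) x : chi x \in char_roots.
Proof.
case: chi => f /=; rewrite /is_group_char => /andP[/forallP f0 /forallP fM].
have fME y w : f (y * w)%g = f y * f w by have /forallP/(_ w)/eqP := fM y.
have f1 : f 1%g = 1.
  by apply: (mulfI (f0 1%g)); rewrite -fME !mulg1 mulr1.
have fX n : f (x ^+ n)%g = f x ^+ n.
  by elim: n => [|n IHn]; rewrite ?expg0 ?f1 // expgS exprS fME IHn.
have n0 : (0 < #|gT|)%N by apply/card_gt0P; exists x.
rewrite /char_roots; case: closed_field_poly_normal => r /= Er.
have: root ('X^#|gT| - 1) (f x).
  rewrite /root !hornerE -fX -cardsT.
  by rewrite expg_cardG ?in_setT // f1 subrr.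
rewrite Er rootZ ?root_prod_XsubC //.
by rewrite (monicP (monicXnsubC _ n0)) oner_eq0.
Qed.

Definition char_code (chi : group_char) : {ffun gT -> seq_sub char_roots} :=
  [ffun x => SeqSub (group_char_rootsP chi x)].

Definition char_decode (h : {ffun gT -> seq_sub char_roots}) :
  option group_char := insub [ffun x => val (h x)].

Fact char_codeK : pcancel char_code char_decode.
Proof.
move=> chi; rewrite /char_decode; set f := finfun _.
have -> : f = val chi by apply/ffunP => x; rewrite !ffunE.
exact: valK.
Qed.

HB.instance Definition _ := PCanIsCountable char_codeK.
HB.instance Definition _ : isFinite group_char := PCanIsFinite char_codeK.

Definition char_ker (chi : group_char) : {set gT} := [set x | chi x == 1].

End Characters.

Section ContractedDeterminant.
Variables (C : numClosedFieldType) (M : finComMonoidType) (z : M).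

Definition nonzero_elt := {m : M | m != z}.

(* Polynomials over C in the variables x_m, m != z; the variable x_m is 'X_i   *)
(* where i is the rank of m in the enumeration of M \ {z}.                     *)
Definition contracted_poly := {mpoly C[#|{: nonzero_elt}|]}.

(* x_m if m != z, and 0 if m = z *)
Definition contracted_var (m : M) : contracted_poly :=
  if insub m is Some u then 'X_(enum_rank (u : nonzero_elt)) else 0.

Definition contracted_mx : 'M[contracted_poly]_#|{: nonzero_elt}| :=
  \matrix_(i, j)
    contracted_var (val (enum_val i : nonzero_elt) *
                    val (enum_val j : nonzero_elt))%g.

Definition contracted_det : contracted_poly := \det contracted_mx.

End ContractedDeterminant.

(* The largest i <= k such that the stabilizer of t ^ i is contained in the    *)
(* kernel of chi; i = 0 always qualifies since the stabilizer of 1 is trivial. *)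
Definition char_level (C : numClosedFieldType) (M : finComMonoidType)
    (t : M) (k : nat) (chi : group_char (munit M) C) : nat :=
  \max_(i < k.+1 | unit_stab (t ^+ i)%g \subset char_ker chi) i.

(* Main.v *)
(* Let G act on M. Every nonzero element of M is g t^i for a unique i <= k, so
   M \ {z} is the union of the orbits G t^i, of sizes |G : G_i|. The pairs
   (chi, i) with G_i contained in the kernel of chi, i.e. with i <= i_chi, are
   equinumerous with M \ {z}, because |G : H| characters of G are trivial on a
   subgroup H. Let W be the square matrix whose row (chi, i) is the Fourier
   transform of the orbit G t^i at chi. Orthogonality of characters makes W W^T
   a monomial matrix (it pairs chi with its inverse) with entries |G| |G_i|.
   It also makes W X W^T block diagonal, X being the contracted multiplication
   table: the chi block is the Hankel matrix with (i, j) entry |G| y_(i+j),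
   y_l = sum_g conj(chi(g)) x_(g t^l), and y_l = 0 for l > i_chi, as then either
   t^l = z or chi is nontrivial on G_l. Comparing determinants gives the formula,
   up to the signs of the permutations involved. *)
Require Import Defs.
From HB Require Import structures.
From mathcomp Require Import all_boot all_order all_algebra all_fingroup.
From mathcomp Require Import cyclic reals complex mpoly.
From mathcomp Require Import separable cyclotomic.
Import GRing.Theory Num.Theory.
Local Open Scope ring_scope.

Set Implicit Arguments.
Unset Strict Implicit.
Unset Printing Implicit Defensive.

(** * Orthogonality and inversion of characters *)

Section CharacterTheory.
Variables (gT : finGroupType) (C : numClosedFieldType).
Implicit Types (chi psi : group_char gT C) (x y : gT).

Lemma group_charM chi x y : chi (x * y)%g = chi x * chi y.
Proof.
case: chi => f /=; rewrite /is_group_char => /andP[_ /forallP/(_ x)/forallP/(_ y)].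
by move/eqP.
Qed.

Lemma group_char_neq0 chi x : chi x != 0.
Proof.
by case: chi => f /=; rewrite /is_group_char => /andP[/forallP/(_ x)].
Qed.

Lemma group_char1 chi : chi 1%g = 1.
Proof. by apply: (mulfI (group_char_neq0 chi 1%g)); rewrite -group_charM mulg1 mulr1. Qed.

Lemma group_charMV chi x : chi x * chi x^-1%g = 1.
Proof. by rewrite -group_charM mulgV group_char1. Qed.

Lemma group_charP chi psi : (forall x, chi x = psi x) -> chi = psi.
Proof. by move=> e; apply/val_inj/ffunP. Qed.

(** Translation by [a] permutes the terms and multiplies the sum by [f a], which differs from 1. *)
Lemma sum_translate_eq0 (a : gT) (f : gT -> C) :
  (forall x, f (a * x)%g = f a * f x) -> f a != 1 -> \sum_x f x = 0.
Proof.
move=> fa fa1; set s := \sum_x _.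
have : s = f a * s.
  rewrite {1}/s (reindex_inj (mulgI a)) /= mulr_sumr.
  by apply: eq_bigr => x _; rewrite fa.
move/eqP; rewrite -subr_eq0 -{1}[s]mul1r -mulrBl mulf_eq0 subr_eq0.
by rewrite eq_sym (negPf fa1) => /eqP.
Qed.

(** The argument [x^-1] is the one produced by the substitution that decouples the double sum in
    [fourier_contraction]. *)
Lemma char_orthogonality chi psi :
  \sum_x (chi x)^* * (psi x^-1%g)^* = #|gT|%:R *+ (chi == psi).
Proof.
case: eqP => [->|neq].
  under eq_bigr do rewrite -rmorphM group_charMV rmorph1.
  by rewrite sumr_const mulr1n.
have [a ha|eqcp] := pickP (fun x => chi x != psi x); last first.
  by case: neq; apply: group_charP => x; apply/eqP; apply: negbFE (eqcp x).
apply: (@sum_translate_eq0 a (fun x => (chi x)^* * (psi x^-1%g)^*)) => [x|].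
- by rewrite invMg !group_charM !rmorphM /= [X in _ * X]mulrC mulrACA.
rewrite -rmorphM -(rmorph1 Num.conj) (inj_eq (fmorph_inj _)).
apply: contra ha => /eqP e.
by rewrite -[chi a]mulr1 -(group_charMV psi a) mulrCA e mulr1.
Qed.

Fact inv_char_subproof chi : is_group_char [ffun x => (chi x)^-1].
Proof.
apply/andP; split; apply/forallP => x; first by rewrite ffunE invr_eq0 group_char_neq0.
by apply/forallP => y; rewrite !ffunE group_charM invfM.
Qed.

Definition inv_char chi : group_char gT C := GroupChar (inv_char_subproof chi).

Lemma inv_charE chi x : inv_char chi x = chi x^-1%g.
Proof.
rewrite /= ffunE; apply: (mulfI (group_char_neq0 chi x)).
by rewrite group_charMV divff ?group_char_neq0.
Qed.

Lemma inv_charK : involutive inv_char.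
Proof. by move=> chi; apply: group_charP => x; rewrite !inv_charE invgK. Qed.

Lemma char_ker_inv chi : char_ker (inv_char chi) = char_ker chi.
Proof. by apply/setP => x; rewrite !inE /= ffunE invr_eq1. Qed.

End CharacterTheory.

(** * Diagonalization of permutation matrices and separation by characters *)

(** The minimal polynomial divides ['X^m - 1], which splits and is separable in characteristic 0. *)
Lemma diagonalizable_finite_order (F : numClosedFieldType) n (A : 'M[F]_n.+1) m :
  (0 < m)%N -> A ^+ m = 1 -> diagonalizable A.
Proof.
move=> m0 Am1; apply/diagonalizableP.
have [rs Drs] := closed_field_poly_normal ('X^m - 1 : {poly F}).
rewrite (monicP (monicXnsubC 1 m0)) scale1r in Drs.
exists rs; first by rewrite -separable_prod_XsubC -Drs separable_Xn_sub_1 // pnatr_eq0 -lt0n.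
apply/mxminpoly_minP.
by rewrite -Drs rmorphB rmorphXn rmorph1 /= horner_mx_X Am1 subrr.
Qed.

Lemma diagonalizable_perm_mx (F : numClosedFieldType) n (s : 'S_n) :
  diagonalizable (perm_mx s : 'M[F]_n).
Proof.
case: n s => [|n] s.
  by exists 1%:M; rewrite ?unitmx1 //; apply/is_diag_mxP; case.
apply: (@diagonalizable_finite_order _ _ _ #[s]%g) => //.
have -> m : (perm_mx s : 'M[F]_n.+1) ^+ m = perm_mx (s ^+ m)%g.
  by elim: m => [|m IHm]; rewrite ?expg0 ?perm_mx1 // exprS expgS perm_mxM IHm.
by rewrite expg_order perm_mx1.
Qed.

(* Diagonalize the regular representation: each diagonal entry is a character,
   and if all of them were trivial at g, then g would act trivially. *)
Lemma char_separation1 (gT : finGroupType) (C : numClosedFieldType) (g : gT) :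
  abelian [set: gT] -> g != 1%g -> exists chi : group_char gT C, chi g != 1.
Proof.
move=> abG g1; set n := #|gT|.
have sI x : injective (fun i : 'I_n => enum_rank (enum_val i * x)%g).
  by move=> i j /enum_rank_inj /mulIg /enum_val_inj.
pose s x := perm (sI x).
have sM x y : s (x * y)%g = (s x * s y)%g.
  by apply/permP => i; rewrite permM !permE enum_rankK mulgA.
pose A x : 'M[C]_n := perm_mx (s x).
have AM x y : A (x * y)%g = A x *m A y by rewrite /A sM perm_mxM.
have [P Pu /allP Pd] : codiagonalizable [seq A x | x <- enum gT].
  apply/codiagonalizableP; split; last by move=> _ /mapP[x _ ->]; apply: diagonalizable_perm_mx.
  move=> _ _ /mapP[x _ ->] /mapP[y _ ->]; rewrite /comm_mx -!AM.
  by congr A; apply: (centsP abG); rewrite inE.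
pose D x := P *m A x *m invmx P.
have Dd x i j : i != j -> D x i j = 0.
  move=> ij; apply: (diagonalizable_forP _ Pu) ij.
  by apply: Pd; apply: map_f; rewrite mem_enum.
have DM x y : D (x * y)%g = D x *m D y.
  by rewrite /D AM !mulmxA mulmxKV.
have D1 : D 1%g = 1%:M.
  have s1 : s 1%g = 1%g by apply/permP=> i; rewrite permE perm1 mulg1 enum_valK.
  by rewrite /D /A s1 perm_mx1 mulmx1 mulmxV.
have DiM i x y : D (x * y)%g i i = D x i i * D y i i.
  rewrite DM mxE (bigD1 i) //= big1 ?addr0 // => j ji.
  by rewrite Dd 1?eq_sym // mul0r.
have charD i : is_group_char [ffun x => D x i i].
  apply/andP; split; apply/forallP => x; last by apply/forallP => y; rewrite !ffunE DiM.
  have := DiM i x x^-1%g; rewrite mulgV D1 mxE eqxx ffunE => e.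
  by apply: contra_eq_neq e => ->; rewrite mul0r oner_eq0.
have [i Dgi|Dg1] := pickP (fun i => D g i i != 1).
  by exists (GroupChar (charD i)); rewrite /= ffunE.
have Dg : D g = 1%:M.
  apply/matrixP => i j; rewrite [RHS]mxE; have [<-|ij] := eqVneq i j; last exact: Dd.
  by apply/eqP; apply: negbFE (Dg1 i).
have Ag : A g = 1%:M.
  by rewrite -[A g](mulKmx Pu) -[P *m A g](mulmxKV Pu) -/(D g) Dg mul1mx mulVmx.
have := congr1 (fun B : 'M_n => B (enum_rank (1%g : gT)) (enum_rank g)) Ag.
rewrite !mxE permE enum_rankK mul1g eqxx (inj_eq enum_rank_inj) eq_sym (negPf g1).
by move/eqP; rewrite oner_eq0.
Qed.

(** * Counting the characters trivial on a subgroup *)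

Section AnnihilatorCount.
Variables (gT : finGroupType) (C : numClosedFieldType).
Hypothesis abG : abelian [set: gT].
Implicit Types (chi : group_char gT C) (H : {group gT}).

(** The coset of [g] is nontrivial in the quotient by [H]; a character separating it from 1 is
    inflated to the whole group. *)
Lemma char_separation H (g : gT) :
  g \notin H -> exists2 chi : group_char gT C, H \subset char_ker chi & chi g != 1.
Proof.
move=> gH; have nH x : x \in 'N(H)%g.
  by apply: (subsetP (sub_abelian_norm abG (subsetT H))); rewrite inE.
have abQ : abelian [set: coset_of H] by rewrite -quotientT quotient_abelian.
have g1 : coset H g != 1%g by apply: contra gH => /eqP/coset_idr; apply.
have [chi chig] := char_separation1 C abQ g1.
have chiP : is_group_char [ffun x => chi (coset H x)].
  apply/andP; split; apply/forallP => x; first by rewrite ffunE group_char_neq0.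
  by apply/forallP => y; rewrite !ffunE morphM // group_charM.
exists (GroupChar chiP); rewrite /= ?ffunE //.
by apply/subsetP => h hH; rewrite inE /= ffunE coset_id // group_char1.
Qed.

Fact mul_char_subproof chi (psi : group_char gT C) :
  is_group_char [ffun x => chi x * psi x].
Proof.
apply/andP; split; apply/forallP => x; first by rewrite ffunE mulf_neq0 ?group_char_neq0.
by apply/forallP => y; rewrite !ffunE !group_charM mulrACA.
Qed.

Definition mul_char chi psi := GroupChar (mul_char_subproof chi psi).

Lemma mul_charI chi : injective (mul_char chi).
Proof.
move=> psi1 psi2 /(congr1 (fun f : group_char gT C => f : gT -> C)) e.
apply: group_charP => x; apply: (mulfI (group_char_neq0 chi x)).
by move/(congr1 (@^~ x)): e; rewrite /= !ffunE.
Qed.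

Fact one_char_subproof : is_group_char [ffun _ : gT => 1 : C].
Proof.
apply/andP; split; apply/forallP => x; first by rewrite ffunE oner_neq0.
by apply/forallP => y; rewrite !ffunE mulr1.
Qed.

Definition one_char := GroupChar one_char_subproof.

(* Both sides evaluate the sum of chi x over all x and all chi trivial on H:
   summing over x first, only the trivial character contributes; summing over
   chi first, only the elements of H do. *)
Lemma card_annihilator H :
  (#|[set chi : group_char gT C | H \subset char_ker chi]| * #|H| = #|gT|)%N.
Proof.
set K := [set _ | _]; apply/eqP; rewrite -(eqr_nat C).
have <- : \sum_(chi in K) \sum_x chi x = #|gT|%:R.
  rewrite (bigD1 one_char) /=; last first.
    by rewrite inE; apply/subsetP => x _; rewrite inE ffunE.
  under eq_bigr do rewrite ffunE.
  rewrite sumr_const big1 ?addr0 // => chi /andP[_ chi1].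
  have [a ha|no] := pickP (fun x => chi x != 1); last first.
    case/eqP: chi1; apply: group_charP => x.
    by rewrite ffunE; apply/eqP; apply: negbFE (no x).
    by apply: (@sum_translate_eq0 _ _ a chi) ha => x; apply: group_charM.
rewrite exchange_big /= (bigID (mem H)) /= [X in _ + X]big1 ?addr0; last first.
  move=> g /char_separation[psi psiH psig]; set s := \sum_(_ in _) _.
  have : s = psi g * s.
    rewrite {1}/s (reindex_inj (@mul_charI psi)) /= mulr_sumr.
    apply: eq_big => [chi|chi _]; last by rewrite ffunE.
    have kerE h : h \in H -> (h \in char_ker (mul_char psi chi)) = (h \in char_ker chi).
      by move/(subsetP psiH); rewrite !inE ffunE => /eqP->; rewrite mul1r.
    by rewrite !inE; apply/subsetP/subsetP => sub h hH; move: (sub h hH); rewrite kerE.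
  move/eqP; rewrite -subr_eq0 -{1}[s]mul1r -mulrBl mulf_eq0 subr_eq0.
  by rewrite eq_sym (negPf psig) => /eqP.
rewrite (eq_bigr (fun _ => #|K|%:R)) => [|g gH]; last first.
  rewrite (eq_bigr (fun _ => 1)) ?sumr_const // => chi.
  by rewrite inE => /subsetP/(_ g gH); rewrite inE => /eqP.
by rewrite sumr_const natrM mulr_natr.
Qed.

End AnnihilatorCount.

(** * Determinants of matrices triangular up to a permutation *)

(** Permuting the columns by [sigma] leaves a matrix that is triangular for the rank [r], so only
    the identity contributes to its Leibniz expansion. *)
Lemma det_perm_triangular (R : comNzRingType) n (T : finType) (f : 'I_n -> T)
    (F : T -> T -> R) (sigma : T -> T) (r : T -> nat) :
  bijective f -> injective sigma ->
  (forall p q, F p (sigma q) != 0 -> p = q \/ (r p < r q)%N) ->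
  exists e : bool,
    \det (\matrix_(i, j) F (f i) (f j)) = (-1) ^+ e * \prod_p F p (sigma p).
Proof.
move=> fbij sI Fr; have [g fK gK] := fbij; have fI := can_inj fK.
have tI : injective (fun i => g (sigma (f i))).
  by move=> i j /(can_inj gK)/sI/fI.
set A := \matrix_(i, j) _; pose B := col_perm (perm tI) A.
have BE i j : B i j = F (f i) (sigma (f j)) by rewrite !mxE permE gK.
have detB : \det B = \prod_p F p (sigma p).
  rewrite /determinant (bigD1 (1%g : 'S_n)) //= odd_perm1 expr0 mul1r [X in _ + X]big1 ?addr0; last first.
    move=> u u1; have [i Bi0|B0] := pickP (fun i => B i (u i) == 0).
      by rewrite (bigD1 i) //= (eqP Bi0) mul0r mulr0.
    have ru i : (r (f i) <= r (f (u i)))%N /\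
        (u i != i -> r (f i) < r (f (u i)))%N.
      have := negbT (B0 i); rewrite BE => /Fr[/fI <-|lt]; first by rewrite eqxx.
      by split=> //; apply: ltnW.
    have [i ui] : exists i, u i != i.
      apply/existsP; apply: contraR u1; rewrite negb_exists => /forallP u1.
      by apply/eqP/permP => i; rewrite perm1; apply/eqP; rewrite -[_ == _]negbK u1.
    (* Ranks never drop along [u] and grow at a moved point, yet [u] merely rearranges them: a
       contradiction. *)
    have : (\sum_i r (f i) < \sum_i r (f (u i)))%N.
      rewrite (bigD1 i) //= [ltnRHS](bigD1 i) //= -addSn.
      by rewrite leq_add //; [case: (ru i) => _ -> | apply: leq_sum => j _; case: (ru j)].
    by rewrite [ltnLHS](reindex_inj (@perm_inj _ u)) ltnn.
  rewrite (reindex f) /=; last exact: onW_bij.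
  by apply: eq_bigr => i _; rewrite BE perm1.
exists (odd_perm (perm tI)); rewrite -detB /B col_permE det_mulmx det_perm.
by rewrite odd_permV mulrCA -signr_addb addbb mulr1.
Qed.

(** * Stabilizers and orbits under the unit group *)

Section UnitsOfCommutativeMonoid.
Variable M : finComMonoidType.
Implicit Types (m x y : M) (g h u : munit M).

(* These laws of M are restated because rewriting with the generic ones leaves
   convertible but syntactically different instances of the product behind. *)
Lemma comMonoid_mulA x y w : (x * (y * w) = x * y * w)%g.
Proof. exact: mulgA. Qed.

Lemma comMonoid_mul1 x : (1 * x = x)%g.
Proof. exact: mul1g. Qed.

Lemma comMonoid_expD x (m n : nat) : (x ^+ (m + n) = x ^+ m * x ^+ n)%g.
Proof. exact: expgnDr. Qed.

Lemma comMonoid_mulACA x1 x2 y1 y2 : (x1 * y1 * (x2 * y2) = x1 * x2 * (y1 * y2))%g.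
Proof. by rewrite !mulgA -(mulgA x1) (mulmC y1) !mulgA. Qed.

Lemma munit_abelian : abelian [set: munit M].
Proof. by apply/centsP => g _ h _; apply: val_inj; apply: mulmC. Qed.

Lemma munit_val1 : munit_val (1%g : munit M) = 1%g.
Proof. by []. Qed.

Lemma munit_valM g h : munit_val (g * h)%g = (munit_val g * munit_val h)%g.
Proof. by []. Qed.

Lemma munit_mulKm g : cancel (mul (munit_val g)) (mul (munit_val g^-1%g)).
Proof. by move=> x; rewrite comMonoid_mulA -munit_valM mulVg munit_val1 comMonoid_mul1. Qed.

Lemma unit_stab_group_set x : group_set (unit_stab x).
Proof.
apply/group_setP; split; first by rewrite inE munit_val1 comMonoid_mul1.
by move=> g h; rewrite !inE munit_valM -comMonoid_mulA => /eqP gx /eqP->; rewrite gx.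
Qed.

Definition unit_stab_group x := Group (unit_stab_group_set x).

Lemma unit_stab_mulr x y : unit_stab x \subset unit_stab (x * y)%g.
Proof. by apply/subsetP => g; rewrite !inE comMonoid_mulA => /eqP->. Qed.

Lemma unit_stabX (t : M) i j : (i <= j)%N -> unit_stab (t ^+ i)%g \subset unit_stab (t ^+ j)%g.
Proof. by move=> /subnKC <-; rewrite comMonoid_expD unit_stab_mulr. Qed.

Definition unit_orbit x : {set M} := [set (munit_val g * x)%g | g : munit M].

Lemma mem_unit_orbit g x : (munit_val g * x)%g \in unit_orbit x.
Proof. exact: imset_f. Qed.

Lemma mem_principal_ideal m x : (m * x)%g \in principal_ideal x.
Proof. exact: imset_f. Qed.

(** The units carrying [x] to [g * x] form the coset of [unit_stab x] through [g]. *)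
Lemma sum_unit_fiber (V : nmodType) x g (F : munit M -> V) :
  \sum_(h | (munit_val h * x == munit_val g * x)%g) F h
    = \sum_(s in unit_stab x) F (g * s)%g.
Proof.
rewrite (reindex_inj (mulgI g)); apply: eq_bigl => s.
by rewrite inE munit_valM -comMonoid_mulA (can_eq (munit_mulKm g)).
Qed.

Lemma card_unit_orbit x : (#|unit_orbit x| * #|unit_stab x| = #|{: munit M}|)%N.
Proof.
rewrite -sum_nat_const -[RHS]sum1_card.
rewrite (partition_big_imset (fun g => munit_val g * x)%g).
apply: eq_bigr => _ /imsetP[g _ ->].
by rewrite sum_unit_fiber sum1_card.
Qed.

End UnitsOfCommutativeMonoid.

(** * Powers of the generator, orbits and ideals *)

Section PrincipalNilpotentMaximalIdeal.
Variables (M : finComMonoidType) (z t : M) (k : nat).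
Hypothesis hz : is_zero z.
Hypothesis hgen : nonunits M = principal_ideal t.
Hypothesis hk : (t ^+ k)%g != z.
Hypothesis hkmax : forall j : nat, (t ^+ j)%g != z -> (j <= k)%N.
Implicit Types (m x y : M) (g h : munit M).

Lemma expt_eqz i : ((t ^+ i)%g == z) = (k < i)%N.
Proof.
apply/idP/idP => [/eqP tiz|].
  rewrite ltnNge; apply: contraL hk => /subnKC <-.
  by rewrite comMonoid_expD tiz (hz _).1 negbK.
by rewrite ltnNge; apply: contraR => /hkmax.
Qed.

Lemma munit_mul_eqz g x : ((munit_val g * x)%g == z) = (x == z).
Proof.
apply/eqP/eqP => [gx|->]; last by rewrite (hz _).2.
by rewrite -[x](munit_mulKm g) gx (hz _).2.
Qed.

(** Factors [t] are split off until the cofactor is a unit. If this has not happened after [k.+1]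
    factors, the element is [z], itself equal to [t ^+ k.+1]. *)
Lemma unit_expt_decomposition x :
  exists g i, (i <= k.+1)%N /\ x = (munit_val g * t ^+ i)%g.
Proof.
have dec n : (exists g i, (i <= n)%N /\ x = (munit_val g * t ^+ i)%g) \/
             exists y, x = (y * t ^+ n)%g.
  elim: n => [|n [[g [i [lein ->]]]|[y ->]]]; first by right; exists x; rewrite mulg1.
    by left; exists g, i; split=> //; apply: leqW.
  have [yi|yn] := boolP (invertible y); first by left; exists (MUnit yi), n.
  have : y \in principal_ideal t by rewrite -hgen inE.
  by case/imsetP=> y' _ ->; right; exists y'; rewrite expgS comMonoid_mulA.
have [//|[y ->]] := dec k.+1; exists 1%g, k.+1; split=> //.
have /eqP-> : (t ^+ k.+1)%g == z by rewrite expt_eqz.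
by rewrite !(hz _).2.
Qed.

(** If [i < j], multiplication by [t ^+ (k - i)] makes the left side a unit times [t ^+ k], which is
    nonzero, and the right side [z]. *)
Lemma expt_orbit_inj g h i j : (i <= k)%N -> (j <= k)%N ->
  (munit_val g * t ^+ i)%g = (munit_val h * t ^+ j)%g -> i = j.
Proof.
have half g' h' a b : (a <= k)%N ->
    (munit_val g' * t ^+ a)%g = (munit_val h' * t ^+ b)%g -> (b <= a)%N.
  move=> lak e; rewrite leqNgt; apply: contra hk => ltab.
  rewrite -(munit_mul_eqz g') -(subnKC lak) comMonoid_expD comMonoid_mulA e -comMonoid_mulA -comMonoid_expD.
  by rewrite munit_mul_eqz expt_eqz addnBA // ltn_subRL -addSn leq_add2r // addnC.
by move=> ik jk e; apply/eqP; rewrite eqn_leq (half _ _ _ _ jk (esym e)) (half _ _ _ _ ik e).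
Qed.

(** Each nonzero element lies in exactly one orbit: [unit_expt_decomposition] gives existence,
    [expt_orbit_inj] uniqueness. *)
Lemma card_nonzero_elt :
  #|{: nonzero_elt z}| = (\sum_(i < k.+1) #|unit_orbit (t ^+ i)%g|)%N.
Proof.
rewrite card_sig -sum1_card (eq_bigr (fun i : 'I__ => \sum_(m in unit_orbit (t ^+ i)%g) 1)%N); last first.
  by move=> i _; rewrite sum1_card.
rewrite (exchange_big_dep (fun m => m != z)) /=; last first.
  by move=> i _ _ /imsetP[g _ ->]; rewrite munit_mul_eqz expt_eqz -leqNgt -ltnS.
apply: eq_bigr => m mz; have [g [i [lei em]]] := unit_expt_decomposition m.
have {lei} ltik : (i < k.+1)%N.
  by move: mz; rewrite inE em munit_mul_eqz expt_eqz -leqNgt.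
rewrite (bigD1 (Ordinal ltik)) /=; last by rewrite em mem_unit_orbit.
rewrite big1 // => j /andP[/imsetP[h _ emh]] /eqP[]; apply: val_inj => /=.
by apply: (@expt_orbit_inj h g _ _ (ltn_ord j) ltik); rewrite -emh.
Qed.

Lemma principal_ideal_is_ideal x : is_ideal (principal_ideal x).
Proof.
split=> [|m _ /imsetP[y _ ->]]; last by rewrite comMonoid_mulA mem_principal_ideal.
by apply/set0Pn; exists (1 * x)%g; apply: mem_principal_ideal.
Qed.

Lemma principal_ideal_sub J x : is_ideal J -> x \in J -> principal_ideal x \subset J.
Proof. by move=> [_ JM] xJ; apply/subsetP => _ /imsetP[m _ ->]; apply: JM. Qed.

Lemma sub_principal_ideal_expt i j :
  (i <= j)%N -> principal_ideal (t ^+ j)%g \subset principal_ideal (t ^+ i)%g.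
Proof.
move=> /subnK <-; apply: principal_ideal_sub; first exact: principal_ideal_is_ideal.
by rewrite comMonoid_expD mem_principal_ideal.
Qed.

(** An ideal is generated by its power of [t] of least exponent, since units can be cancelled from
    its elements [g * t ^+ j]. *)
Lemma idealP (J : {set M}) :
  is_ideal J <-> exists2 i : nat, (i <= k.+1)%N & J = principal_ideal (t ^+ i)%g.
Proof.
split=> [idJ|[i _ ->]]; last exact: principal_ideal_is_ideal.
have [/set0Pn[x xJ] JM] := idJ.
(* Every ideal contains [z], which is [t ^+ k.+1]; this also bounds the least exponent by [k.+1]. *)
have exi : exists i, (t ^+ i)%g \in J.
  exists k.+1; have /eqP-> : (t ^+ k.+1)%g == z by rewrite expt_eqz.
  by rewrite -(hz x).1; apply: JM.
exists (ex_minn exi); case: ex_minnP => i tiJ mini.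
  apply: mini; have /eqP-> : (t ^+ k.+1)%g == z by rewrite expt_eqz.
  by rewrite -(hz x).1; apply: JM.
apply/eqP; rewrite eqEsubset principal_ideal_sub // andbT.
apply/subsetP => y yJ; have [g [j [_ ey]]] := unit_expt_decomposition y.
have leij : (i <= j)%N.
  by apply: mini; rewrite -[(t ^+ j)%g](munit_mulKm g) -ey; apply: JM.
by apply: (subsetP (sub_principal_ideal_expt leij)); rewrite ey mem_principal_ideal.
Qed.

(** * Levels of characters and the index set of the Fourier matrix *)

Section Level.
Variable C : numClosedFieldType.
Implicit Types (chi psi : group_char (munit M) C).

(** Stabilizers grow with the exponent, so the admissible exponents form an initial segment; it
    contains 0, so the maximum is attained. *)
Lemma char_level_leq chi i : (i <= char_level t k chi)%N =
  (i <= k)%N && (unit_stab (t ^+ i)%g \subset char_ker chi).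
Proof.
have lev0 : #|[pred i : 'I_k.+1 | unit_stab (t ^+ i)%g \subset char_ker chi]| != 0%N.
  rewrite -lt0n; apply/card_gt0P; exists ord0; rewrite inE.
  apply/subsetP => g; rewrite !inE mulg1 => /eqP g1.
  by rewrite (_ : g = 1%g) ?group_char1 //; apply: val_inj.
rewrite -lt0n in lev0; have [i0 ker0 lev] := eq_bigmax_cond (@nat_of_ord k.+1) lev0.
apply/idP/andP => [|[leik ker]]; last first.
  by apply: (@leq_bigmax_cond _ _ (@nat_of_ord k.+1) (Ordinal (leik : i < k.+1)%N)).
rewrite [char_level _ _ _]lev => le_i; split; first exact: leq_trans le_i (ltn_ord i0).
exact: subset_trans (unit_stabX _ le_i) ker0.
Qed.

Lemma char_level_inv chi : char_level t k (inv_char chi) = char_level t k chi.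
Proof. by rewrite /char_level; apply: eq_bigl => i; rewrite char_ker_inv. Qed.

Definition char_index : finType :=
  {p : group_char (munit M) C * 'I_k.+1 | (p.2 <= char_level t k p.1)%N}.

Lemma big_char_index (R : comPzSemiRingType) (F : group_char (munit M) C -> nat -> R) :
  \prod_(p : char_index) F (val p).1 (val p).2 =
  \prod_chi \prod_(i < (char_level t k chi).+1) F chi i.
Proof.
pose P (p : group_char (munit M) C * 'I_k.+1) := (p.2 <= char_level t k p.1)%N.
rewrite -(big_sub P (fun p => F p.1 p.2)).
rewrite -(pair_big_dep xpredT (fun chi (i : 'I_k.+1) => i <= char_level t k chi)%N F) /=.
apply: eq_bigr => chi _; rewrite (big_ord_widen k.+1 (F chi)) ?ltnS //.
by have := leqnn (char_level t k chi); rewrite char_level_leq => /andP[].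
Qed.

(** This makes the Fourier matrix square. For each [i], the orbit of [t ^+ i] and the set of
    characters trivial on its stabilizer have the same size, the index of that stabilizer. *)
Lemma card_char_index : #|char_index| = #|{: nonzero_elt z}|.
Proof.
rewrite card_nonzero_elt card_sig -sum1_card.
rewrite -(pair_big_dep xpredT (fun chi (i : 'I_k.+1) => i <= char_level t k chi)%N (fun _ _ => 1%N)) /=.
rewrite (exchange_big_dep xpredT) //=; apply: eq_bigr => i _.
rewrite sum1_card; apply/eqP.
have /eqn_pmul2r <- : (0 < #|unit_stab (t ^+ i)%g|)%N.
  exact: (cardG_gt0 (unit_stab_group _)).
rewrite card_unit_orbit -(card_annihilator C (munit_abelian M) (unit_stab_group (t ^+ i)%g)).
rewrite eqn_pmul2r; last exact: (cardG_gt0 (unit_stab_group _)).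
apply/eqP; apply: eq_card => chi; rewrite inE -[LHS]/(i <= char_level t k chi)%N.
by rewrite char_level_leq -ltnS ltn_ord.
Qed.

(** * Fourier transform of the contracted multiplication table *)

Local Notation xvar := (contracted_var C z).

(* The coefficient of x_m in fourier_var chi i. *)
Definition fourier_weight chi i m : C :=
  \sum_(g | (munit_val g * t ^+ i == m)%g) (chi g)^*.

(** The sum over units makes sense for [i > k] too, where it is 0; such exponents arise as [i + j]
    in [fourier_contraction]. *)
Definition fourier_var chi i : contracted_poly C z :=
  \sum_g (chi g)^* *: xvar (munit_val g * t ^+ i)%g.

(** The bound on [i] keeps the whole orbit away from [z], which the left-hand sum omits. *)
Lemma sum_fourier_weight (V : lmodType C) chi i (f : M -> V) : (i <= k)%N ->
  \sum_(m : nonzero_elt z) fourier_weight chi i (val m) *: f (val m) =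
  \sum_g (chi g)^* *: f (munit_val g * t ^+ i)%g.
Proof.
move=> leik; under eq_bigr do rewrite scaler_suml.
rewrite (exchange_big_dep xpredT) //=; apply: eq_bigr => g _.
have nz : (munit_val g * t ^+ i)%g != z by rewrite munit_mul_eqz expt_eqz -leqNgt.
rewrite (bigD1 (exist (fun m : M => m != z) _ nz : nonzero_elt z)) //= [X in _ + X]big1 ?addr0 // => m.
by case/andP=> /eqP em /eqP[]; apply: val_inj.
Qed.

Lemma fourier_contraction chi psi i j : (i <= k)%N -> (j <= k)%N ->
  \sum_(m : nonzero_elt z) fourier_weight chi i (val m) *:
    (\sum_(m' : nonzero_elt z) fourier_weight psi j (val m') *: xvar (val m * val m')%g) =
  (#|{: munit M}|%:R *+ (chi == psi)) *: fourier_var chi (i + j).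
Proof.
move=> leik lejk.
under eq_bigr => m _ do rewrite (sum_fourier_weight psi (fun x => xvar (val m * x)%g) lejk).
rewrite (sum_fourier_weight chi (fun y => \sum_h (psi h)^* *: xvar (y * (munit_val h * t ^+ j))%g)) //.
(* The product of [g * t ^+ i] and [h * t ^+ j] depends only on [u = g * h]; taking [u] as the inner
   variable separates the two sums. *)
transitivity (\sum_g ((chi g)^* * (psi g^-1%g)^*) *: fourier_var psi (i + j)).
  apply: eq_bigr => g _; rewrite -scalerA; congr (_ *: _).
  rewrite (reindex_inj (mulgI g^-1%g)) scaler_sumr; apply: eq_bigr => u _.
  rewrite group_charM rmorphM scalerA comMonoid_mulACA -munit_valM mulKVg.
  by rewrite -comMonoid_expD.
by rewrite -scaler_suml char_orthogonality; case: eqP => [->|_] //; rewrite !scale0r.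
Qed.

Lemma fourier_var_eq0 chi i : fourier_var chi i != 0 -> (i <= char_level t k chi)%N.
Proof.
rewrite char_level_leq; apply: contraR; rewrite negb_and => /orP[ltki|].
  rewrite /fourier_var big1 // => g _.
  have /eqP-> : (munit_val g * t ^+ i)%g == z by rewrite munit_mul_eqz expt_eqz ltnNge.
  by rewrite /contracted_var insubF ?eqxx // scaler0.
case/subsetPn=> s; rewrite !inE => /eqP st chis.
(* Replacing [g] by [g * s] leaves every variable unchanged, as [s] fixes [t ^+ i]. *)
have : fourier_var chi i = (chi s)^* *: fourier_var chi i.
  rewrite {1}/fourier_var (reindex_inj (mulIg s)) scaler_sumr.
  apply: eq_bigr => g _; rewrite scalerA -rmorphM mulrC -group_charM.
  by rewrite munit_valM -comMonoid_mulA st.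
move/eqP; rewrite -subr_eq0 -{1}[fourier_var _ _]scale1r -scalerBl scaler_eq0.
by rewrite subr_eq0 eq_sym -(rmorph1 Num.conj) (inj_eq (fmorph_inj _)) (negPf chis).
Qed.

(** Distinct exponents give disjoint orbits. For equal ones, the units with the same image of
    [t ^+ j] form a coset of the stabilizer, and [psi] is constant on it because [j] is at most its
    level; hence the second factor. *)
Lemma fourier_weight_orthogonality chi psi i j :
  (i <= k)%N -> (j <= char_level t k psi)%N ->
  \sum_(m : nonzero_elt z)
      fourier_weight chi i (val m) * fourier_weight (inv_char psi) j (val m) =
  (#|{: munit M}|%:R * #|unit_stab (t ^+ i)%g|%:R) *+ ((chi == psi) && (i == j)).
Proof.
move=> leik lejpsi; have := lejpsi; rewrite char_level_leq => /andP[lejk kerj].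
have := @sum_fourier_weight C^o chi i (fourier_weight (inv_char psi) j) leik.
rewrite /GRing.scale /= => ->.
have [eij|neij] := eqVneq i j; last first.
  rewrite andbF big1 // => g _; rewrite [fourier_weight _ _ _]big1 ?mulr0 // => h /eqP e.
  by case/eqP: neij; apply: (expt_orbit_inj leik lejk (esym e)).
rewrite andbT eij -mulrnAl -char_orthogonality mulr_suml; apply: eq_bigr => g _.
rewrite /fourier_weight (sum_unit_fiber (t ^+ j)%g g) -mulrA; congr (_ * _).
rewrite -sumr_const mulr_sumr; apply: eq_bigr => s sj.
rewrite inv_charE invMg group_charM rmorphM mulrC; congr (_ * _).
have := subsetP kerj s^-1%g; rewrite (groupV (unit_stab_group (t ^+ j)%g)) /= sj.
by rewrite inE => /(_ isT)/eqP->; rewrite rmorph1.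
Qed.

Lemma char_level_max chi : (char_level t k chi <= k)%N.
Proof. by have := leqnn (char_level t k chi); rewrite char_level_leq => /andP[]. Qed.

(** * Permutations of the index set and comparison of determinants *)

Implicit Types p q : char_index.
Local Notation level p := (char_level t k (val p).1).

Lemma level_sub_lt p : (level p - (val p).2 < k.+1)%N.
Proof. by rewrite ltnS (leq_trans (leq_subr _ _)) ?char_level_max. Qed.

Fact level_reflection_subproof p :
  (Ordinal (level_sub_lt p) <= level p)%N.
Proof. exact: leq_subr. Qed.

(** The antidiagonal partner of [p] in the Hankel block of its character. *)
Definition level_reflection p : char_index :=
  exist _ ((val p).1, Ordinal (level_sub_lt p)) (level_reflection_subproof p).

Lemma char_index_eqP p q :
  (val p).1 = (val q).1 -> (val p).2 = (val q).2 :> nat -> p = q.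
Proof.
case: p q => [[chi i] pp] [[psi j] pq] /= e1 e2; apply: val_inj => /=.
by rewrite e1; congr (_, _); apply: val_inj.
Qed.

Lemma level_reflection_inj : injective level_reflection.
Proof.
move=> p q e.
have e1 : (val p).1 = (val q).1 := congr1 (fun r : char_index => (val r).1) e.
have e2 : (level p - (val p).2 = level q - (val q).2)%N :=
  congr1 (fun r : char_index => nat_of_ord (val r).2) e.
apply: char_index_eqP => //.
by rewrite -(subKn (valP p)) e2 e1 subKn // (valP q).
Qed.

Fact inv_index_subproof p : ((val p).2 <= char_level t k (inv_char (val p).1))%N.
Proof. by rewrite char_level_inv; apply: valP p. Qed.

(** The only column where row [p] of the Gram matrix of [fourier_mx] is nonzero. *)
Definition inv_index p : char_index :=
  exist _ (inv_char (val p).1, (val p).2) (inv_index_subproof p).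

Lemma inv_index_inj : injective inv_index.
Proof.
move=> p q e; apply: char_index_eqP.
  by apply: (can_inj (@inv_charK _ _)); apply: (congr1 (fun r : char_index => (val r).1) e).
exact: (congr1 (fun r : char_index => nat_of_ord (val r).2) e).
Qed.

(** The cast gives rows and columns of [fourier_mx] the same index type, so that it has a
    determinant. *)
Definition index_enum_char (a : 'I_#|{: nonzero_elt z}|) : char_index :=
  enum_val (cast_ord (esym card_char_index) a).

Lemma index_enum_char_bij : bijective index_enum_char.
Proof.
apply: inj_card_bij; last by rewrite card_ord card_char_index.
by move=> a b /enum_val_inj/cast_ord_inj.
Qed.

Lemma sum_enum_nonzero (V : nmodType) (F : nonzero_elt z -> V) :
  \sum_(a < #|{: nonzero_elt z}|) F (enum_val a) = \sum_m F m.
Proof. by rewrite [RHS](reindex _ (onW_bij _ (@enum_val_bij _))). Qed.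

Definition fourier_mx : 'M[C]_#|{: nonzero_elt z}| :=
  \matrix_(a, b) fourier_weight (val (index_enum_char a)).1
     (val (index_enum_char a)).2 (val (enum_val b : nonzero_elt z)).

Local Notation fourier_mpoly_mx := (map_mx (@mpolyC _ C) fourier_mx).

(** The transformed table involves [\det fourier_mx] only through its square, the determinant of a
    monomial Gram matrix. *)
Lemma det_fourier_gram : exists e : bool,
  \det fourier_mx ^+ 2 = (-1) ^+ e *
    \prod_(p : char_index) (#|{: munit M}|%:R * #|unit_stab (t ^+ (val p).2)%g|%:R).
Proof.
pose w p m := fourier_weight (val p).1 (val p).2 m.
pose F p q := \sum_(m : nonzero_elt z) w p (val m) * w q (val m).
have FE p q : F p (inv_index q) =
    (#|{: munit M}|%:R * #|unit_stab (t ^+ (val p).2)%g|%:R) *+ (p == q).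
  rewrite /F /w fourier_weight_orthogonality; [|by rewrite -ltnS|exact: (valP q)].
  by [].
(* With a constant rank, the triangularity condition forces [p = q], that is, a monomial matrix. *)
have [|e He] := @det_perm_triangular _ _ _ index_enum_char F inv_index (fun=> 0%N)
  index_enum_char_bij inv_index_inj.
  by move=> p q; rewrite FE; case: (p =P q) => [->|_]; [left | rewrite eqxx].
exists e; rewrite expr2 -{2}det_tr -det_mulmx.
rewrite (eq_bigr (fun p => F p (inv_index p))) => [|p _]; last by rewrite FE eqxx.
rewrite -He; congr (\det _); apply/matrixP => a b; rewrite !mxE.
rewrite /F -sum_enum_nonzero; apply: eq_bigr => c _.
by rewrite !mxE.
Qed.

(* The blocks of the matrix on the left vanish strictly below their antidiagonal
   i + j = level, so composing with level_reflection makes it triangular. *)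
Lemma det_fourier_contraction : exists e : bool,
  \det (fourier_mpoly_mx *m contracted_mx C z *m fourier_mpoly_mx^T) =
  (-1) ^+ e * \prod_(p : char_index) (#|{: munit M}|%:R *: fourier_var (val p).1 (level p)).
Proof.
pose F p q := (#|{: munit M}|%:R *+ ((val p).1 == (val q).1)) *:
   fourier_var (val p).1 ((val p).2 + (val q).2).
have [|e He] := @det_perm_triangular _ _ _ index_enum_char F level_reflection
  (fun p => (val p).2) index_enum_char_bij level_reflection_inj.
  move=> p q; rewrite /F /=; case: ((val p).1 =P (val q).1) => [epq|_]; last by rewrite scale0r eqxx.
  rewrite scaler_eq0 negb_or => /andP[_] /fourier_var_eq0; rewrite epq => le.
  have [|lt] := leqP (val q).2 (val p).2; last by right.
  left; apply: char_index_eqP => //; apply/eqP; rewrite eqn_leq andbC.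
  apply/andP; split=> //; rewrite -(leq_add2r (level q - (val q).2)).
  by rewrite (subnKC (valP q)).
exists e; rewrite (eq_bigr (fun p => F p (level_reflection p))) => [|p _]; last first.
  by rewrite /F /= eqxx (subnKC (valP p)).
rewrite -He; congr (\det _); apply/matrixP => a b; rewrite [RHS]mxE -mulmxA.
rewrite /F -fourier_contraction; [|by rewrite -ltnS|by rewrite -ltnS].
rewrite mxE -sum_enum_nonzero; apply: eq_bigr => c _; rewrite !mxE mul_mpolyC.
congr (_ *: _); rewrite -sum_enum_nonzero; apply: eq_bigr => d _.
by rewrite !mxE mulrC mul_mpolyC.
Qed.

(** Both evaluations of the transformed determinant carry one factor [#|munit M|] per index; these
    cancel, and the stabilizer orders move to the denominator. *)
Lemma det_contracted : exists e : bool,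
  contracted_det C z = (-1) ^+ e *
    \prod_(chi : group_char (munit M) C)
      ((\prod_(i < (char_level t k chi).+1) (#|unit_stab (t ^+ i)%g|%:R : C)^-1) *:
        fourier_var chi (char_level t k chi) ^+ (char_level t k chi).+1).
Proof.
have [e1 gram] := det_fourier_gram; have [e2] := det_fourier_contraction.
rewrite !det_mulmx det_tr det_map_mx mulrAC -expr2 -rmorphXn gram.
rewrite mul_mpolyC scaler_prod big_split /= => contr.
have Gn0 : \prod_(p : char_index) (#|{: munit M}|%:R : C) != 0.
  apply/prodf_neq0 => p _; rewrite pnatr_eq0 -lt0n.
  by apply/card_gt0P; exists (1%g : munit M).
have Sn0 : \prod_(p : char_index) (#|unit_stab (t ^+ (val p).2)%g|%:R : C) != 0.
  apply/prodf_neq0 => p _; rewrite pnatr_eq0 -lt0n.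
  exact: (cardG_gt0 (unit_stab_group _)).
exists (e1 (+) e2).
(* The power is spread over the exponents up to the level, so that both sides become products over
   [char_index]. *)
under eq_bigr => chi _.
  rewrite -[X in _ ^+ X]card_ord -prodr_const -scaler_prod; over.
rewrite -(big_char_index (fun chi i =>
  (#|unit_stab (t ^+ i)%g|%:R : C)^-1 *: fourier_var chi (char_level t k chi))).
(* This nonzero scalar is the value of [\det fourier_mx ^+ 2], by which both sides are
   multiplied. *)
have u0 := mulf_neq0 (negbT (signr_eq0 C e1)) (mulf_neq0 Gn0 Sn0).
apply: (scalerI u0); rewrite contr scaler_prod prodfV.
case: e1 e2 {contr gram u0} => [] [];
  by rewrite /= ?expr0 ?expr1 ?mul1r ?mulN1r ?scaleNr ?scalerN ?opprK scalerA mulfK.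
Qed.

End Level.

End PrincipalNilpotentMaximalIdeal.

Unset Implicit Arguments.

Theorem corollary6p13 (R : realType) (M : finComMonoidType) (z t : M) (k : nat)
  (hz : is_zero z)
  (hnil : nilpotent_elt z t)
  (hgen : nonunits M = principal_ideal t)
  (hk : (t ^+ k)%g != z)
  (hkmax : forall j : nat, (t ^+ j)%g != z -> (j <= k)%N) :
  [/\ forall J : {set M},
        is_ideal J <->
        exists2 i : nat, (i <= k.+1)%N & J = principal_ideal (t ^+ i)%g,
      forall i j : nat, (i <= k.+1)%N -> (j <= k.+1)%N ->
        principal_ideal (t ^+ i)%g \subset principal_ideal (t ^+ j)%g \/
        principal_ideal (t ^+ j)%g \subset principal_ideal (t ^+ i)%g
    & exists e : bool,
        contracted_det R[i] z =
        (-1) ^+ e *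
        \prod_(chi : group_char (munit M) R[i])
          ((\prod_(i < (char_level t k chi).+1)
              (#|unit_stab (t ^+ i)%g|%:R : R[i])^-1) *:
           (\sum_(g : munit M)
              (chi g)^* *: contracted_var R[i] z (munit_val g * t ^+ char_level t k chi)%g)
             ^+ (char_level t k chi).+1)].

Proof.
split; first exact: (idealP hz hgen hk hkmax).
  move=> i j _ _; have [leij|/ltnW leji] := leqP i j.
    by right; apply: sub_principal_ideal_expt.
  by left; apply: sub_principal_ideal_expt.
exact: (det_contracted hz hgen hk hkmax R[i]).
Qed.
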